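(* There is an absolute constant $K$ such that the following holds. Let $P$ be a poset and $d$ a positive integer. Suppose the constant $C$ satisfies: for every positive integer $m$, every family $\mathcal{F}'\subset[m]^d$ not containing an induced (respectively, weak) copy of $P$ has $|\mathcal{F}'|\le C m^{d-1}$. Then for all positive integers $k\ge 2$ and $n\ge d$, every family $\mathcal{F}\subset[k]^n$ not containing an induced (respectively, weak) copy of $P$ satisfies $|\mathcal{F}|\le K C\sqrt d\, w$, where $w$ is the width of $[k]^n$.
   Context: $[k]^n$ denotes $\{1,\dots,k\}^n$ with the coordinatewise partial order. The width of a poset is the size of its largest antichain. A subset $P'\subset Q$ is a weak copy of $P$ if there is a bijection $\pi:P\to P'$ such that $x\le_P y$ implies $\pi(x)\le_Q\pi(y)$; it is an induced copy if moreover $x\le_P y\iff\pi(x)\le_Q\pi(y)$. *)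

(* Defs.v *)
From mathcomp Require Import all_boot.
From Stdlib Require Import Reals.
Set Implicit Arguments. Unset Strict Implicit. Unset Printing Implicit Defensive.

(* The grid [k]^n, represented as {ffun 'I_n -> 'I_k}; coordinate values
   0..k-1 stand for 1..k (order-isomorphic). *)
Definition grid (n k : nat) := {ffun 'I_n -> 'I_k}.

Definition grid_le (n k : nat) (x y : grid n k) : bool := [forall i, x i <= y i].

Definition antichain (n k : nat) (A : {set grid n k}) : bool :=
  [forall x in A, forall y in A, grid_le x y ==> (x == y)].

Definition width (n k : nat) : nat :=
  \max_(A : {set grid n k} | antichain A) #|A|.

Definition has_copy (induced : bool) (T : finType) (leP : rel T) (n k : nat)
  (F : {set grid n k}) : Prop :=
  exists f : T -> grid n k,
    [/\ injective f, (forall x, f x \in F),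
        (forall x y, leP x y -> grid_le (f x) (f y)) &
        (induced -> forall x y, grid_le (f x) (f y) -> leP x y)].

(* Main.v *)
(** Level sizes of [k]^N are log-concave, which yields by induction on N the
    normalized matching property in its fractional form: a random maximal chain
    that is uniform on every level.  Sampling its levels systematically turns it
    into a fractional partition of [k]^N into chains of size m, for every m at
    most k^N / h, where h is the largest level size.  Cut [k]^n into d blocks of
    N = n/d coordinates: products of independent random chains are copies of
    [m]^d covering every point equally often, so averaging the hypothesis over
    them gives |F| <= C k^n / m.  Finally m is at least of order k sqrt N, since a
    log-concave sequence cannot have both a large maximum and a large variance,
    and k^n is at most of order k sqrt n times the width, by Chebyshev's
    inequality. *)

Require Import Defs.
From mathcomp Require Import all_boot all_order all_algebra.
From mathcomp Require Import zify ring lra.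
Set Implicit Arguments. Unset Strict Implicit. Unset Printing Implicit Defensive.

(** * Log-concave level sizes and normalized flows *)

Section RankedPosets.
Import Order.TTheory GRing.Theory Num.Theory.
Local Open Scope ring_scope.
Variable K : realFieldType.

(** The four-point form, unlike the one for adjacent indices, also excludes zeros between two
    nonzero values. *)
Definition log_concave (W : int -> K) := forall a b c e : int,
  a <= b -> a <= c -> a + e = b + c -> W a * W e <= W b * W c.

(** If [W] gives the level sizes of [Q], this counts the points of rank [r] in the product of [Q]
    with a chain whose chain coordinate is below [j]. *)
Definition window (W : int -> K) (r : int) (j : nat) : K :=
  \sum_(i < j) W (r - i%:Z).

Lemma window_recr W r j : window W r j.+1 = window W r j + W (r - j%:Z).
Proof. by rewrite /window big_ord_recr. Qed.

Lemma window_succ W r j : window W (r + 1) j.+1 = W (r + 1) + window W r j.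
Proof.
rewrite /window big_ord_recl subr0; congr (_ + _).
by apply: eq_bigr => i _; congr W; rewrite lift0; lia.
Qed.

Lemma window_ge0 W r j : (forall z, 0 <= W z) -> 0 <= window W r j.
Proof. by move=> W0; apply: sumr_ge0. Qed.

Lemma window_le W r (j k : nat) : (forall z, 0 <= W z) -> (j <= k)%N ->
  window W r j <= window W r k.
Proof.
move=> W0 /subnKC <-; elim: (k - j)%N => [|m IH]; first by rewrite addn0.
by rewrite addnS window_recr (le_trans IH)// lerDl.
Qed.

(** The share of chain coordinates below [j] does not grow with the rank: each term added to the
    long window is compared by log-concavity. This will make [up] nonnegative, and [window_ratio]
    will do so for [stay]. *)
Lemma window_succ_ratio W r (j k : nat) : log_concave W -> (j <= k)%N ->
  window W (r + 1) j * window W r k <= window W r j * window W (r + 1) k.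
Proof.
move=> lcW /subnKC <-; elim: (k - j)%N => [|m IH]; first by rewrite addn0 mulrC.
rewrite addnS !window_recr !mulrDr lerD// /window !mulr_suml; apply: ler_sum => i _.
rewrite mulrC [leRHS]mulrC [leRHS]mulrC; apply: lcW; have := ltn_ord i; lia.
Qed.

Lemma window_ratio W r (j k : nat) : (forall z, 0 <= W z) -> (j < k)%N ->
  window W r j * window W (r + 1) k <= window W (r + 1) j.+1 * window W r k.
Proof.
case: k => // k W0 jk; rewrite !window_succ mulrDr mulrDl lerD//.
  by rewrite mulrC ler_wpM2l// window_le// ltnW.
by rewrite ler_wpM2l ?window_ge0// window_le.
Qed.

Lemma log_concave_window W k :
  log_concave W -> log_concave (fun z => window W z k).
Proof.
move=> lcW.
(* Sliding the window by one gains one term and loses one; [h1] and [h2] compare these two with a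
   whole window, term by term. *)
have dV z : window W (z + 1) k = window W z k + W (z + 1) - W (z + 1 - k%:Z).
  by have := window_recr W (z + 1) k; rewrite window_succ; lra.
have adj a s : a + 1 <= s ->
    window W a k * window W (s + 1) k <= window W (a + 1) k * window W s k.
  move=> las; rewrite !dV.
  have h1 : window W a k * W (s + 1) <= window W s k * W (a + 1).
    rewrite /window !mulr_suml; apply: ler_sum => i _.
    by apply: lcW; lia.
  have h2 : window W s k * W (a + 1 - k%:Z) <= window W a k * W (s + 1 - k%:Z).
    rewrite /window !mulr_suml; apply: ler_sum => i _; rewrite mulrC.
    by apply: lcW; have := ltn_ord i; lia.
  lra.
have gen (n : nat) : forall a c, a <= c ->
    window W a k * window W (c + n%:Z) k <= window W (a + n%:Z) k * window W c k.
  elim: n => [|n IH] a c; first by rewrite !addr0.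
  rewrite le_eqVlt => /predU1P[->|ac]; first by rewrite mulrC.
  have e1 : c + n.+1%:Z = c + n%:Z + 1 by lia.
  have e2 : a + n.+1%:Z = a + 1 + n%:Z by lia.
  rewrite e1 e2; apply: le_trans (IH _ _ _); last by lia.
  by apply: adj; lia.
move=> a b c e ab ac abc.
have -> : b = a + `|b - a|%N%:Z by lia.
have -> : e = c + `|b - a|%N%:Z by lia.
exact: gen.
Qed.

(** Indexing by all integers makes levels out of range empty, so windows need no boundary cases. *)
Definition level_size (Q : finType) (rk : Q -> nat) (z : int) : K :=
  \sum_(x : Q) ((rk x)%:Z == z)%:R.

Lemma level_size_ge0 (Q : finType) (rk : Q -> nat) z : 0 <= level_size rk z.
Proof. by apply: sumr_ge0 => x _; rewrite ler0n. Qed.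

Lemma level_size_gt0 (Q : finType) (rk : Q -> nat) x : 0 < level_size rk (rk x).
Proof.
rewrite /level_size (bigD1 x)//= eqxx ltr_pwDl//.
by apply: sumr_ge0 => y _; rewrite ler0n.
Qed.

Definition prod_le (Q : finType) (le : rel Q) k : rel (Q * 'I_k) :=
  fun p q => le p.1 q.1 && (p.2 <= q.2)%N.
Definition prod_rk (Q : finType) (rk : Q -> nat) k (p : Q * 'I_k) : nat :=
  (rk p.1 + p.2)%N.

Lemma level_size_prod (Q : finType) (rk : Q -> nat) k z :
  level_size (@prod_rk Q rk k) z = window (level_size rk) z k.
Proof.
rewrite /level_size /window exchange_big /=.
rewrite -(pair_bigA _ (fun x (j : 'I_k) => ((rk x + j)%N%:Z == z)%:R)) /=.
apply: eq_bigr => x _; apply: eq_bigr => j _; congr (_%:R : K).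
by congr nat_of_bool; lia.
Qed.

(* [f x y] is the joint law of two uniform random elements of consecutive
   levels; it is the regular covering form of the normalized matching property. *)
Definition normalized_flow (Q : finType) (le : rel Q) (rk : Q -> nat)
    (f : Q -> Q -> K) :=
  [/\ forall x y, 0 <= f x y,
      forall x y, f x y != 0 -> le x y /\ rk y = (rk x).+1,
      forall x, 0 < level_size rk ((rk x)%:Z + 1) ->
        \sum_y f x y = (level_size rk (rk x))^-1 &
      forall y, 0 < level_size rk ((rk y)%:Z - 1) ->
        \sum_x f x y = (level_size rk (rk y))^-1].

Lemma sum_ord_delta k (a : nat) (c : K) :
  \sum_(j < k) (j == a :> nat)%:R * c = if (a < k)%N then c else 0.
Proof.
by rewrite -(big_ord1_eq +%R (fun=> c)) [RHS]big_mkcond; apply: eq_bigr => j _;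
   case: eqP; rewrite ?mul1r ?mul0r.
Qed.

Lemma sum_delta (T : finType) (a : T) (F : T -> K) :
  \sum_x (x == a)%:R * F x = F a.
Proof.
rewrite (bigD1 a)//= eqxx mul1r big1 ?addr0// => x /negbTE->.
by rewrite mul0r.
Qed.

(** Monotone coupling of the chain coordinates on consecutive levels: mass either keeps its
    coordinate and moves in [Q] along [f], or keeps its point of [Q] and raises the coordinate by
    one. *)
Lemma normalized_flow_prod (Q : finType) (le : rel Q) (rk : Q -> nat) k f :
  reflexive le -> log_concave (level_size rk) -> normalized_flow le rk f ->
  exists g, normalized_flow (@prod_le Q le k) (@prod_rk Q rk k) g.
Proof.
move=> lexx lcW [f0 fle fout fin]; set W := level_size rk in lcW fout fin.
have W0 z : 0 <= W z by exact: level_size_ge0.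
pose V r := window W r k.
(* Distribution function of the chain coordinate of a uniform point of rank [r]. *)
pose A r j := window W r j / V r.
have V0 r : 0 <= V r by exact: window_ge0.
have A0 r : A r 0%N = 0 by rewrite /A /window big_ord0 mul0r.
have AS r j : A r j.+1 = A r j + W (r - j%:Z) / V r.
  by rewrite /A window_recr mulrDl.
(* When one of two consecutive levels is empty, nothing has to flow. *)
pose full r := (0 < V r) && (0 < V (r + 1)).
(* The mass that has to cross from coordinate [j] to [j.+1]; [stay] is the rest of the mass at
   [j]. *)
pose up r j := if full r then A r j.+1 - A (r + 1) j.+1 else 0.
pose stay r j := if full r then A (r + 1) j.+1 - A r j else 0.
have up0 r j : (j < k)%N -> 0 <= up r j.
  rewrite /up; case: ifP => // /andP[v v'] jk.
  rewrite subr_ge0 /A ler_pdivrMr// mulrAC ler_pdivlMr//.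
  exact: window_succ_ratio.
have stay0 r j : (j < k)%N -> 0 <= stay r j.
  rewrite /stay; case: ifP => // /andP[v v'] jk.
  rewrite subr_ge0 /A ler_pdivrMr// mulrAC ler_pdivlMr//.
  exact: window_ratio.
have outE r j : full r -> stay r j + up r j = W (r - j%:Z) / V r.
  by move=> fr; rewrite /stay /up fr (AS r); ring.
(* Mass entering chain coordinate [j]; nothing comes from below [j = 0]. *)
pose into r j := if j is i.+1 then up r i else 0.
have inE r j : full r -> stay r j + into r j = W (r + 1 - j%:Z) / V (r + 1).
  move=> fr; rewrite /stay /into fr AS; case: j => [|j].
    by rewrite !A0 add0r subr0 addr0.
  by rewrite /up fr; ring.
have into0 r j : (j < k)%N -> 0 <= into r j.
  by case: j => //= j jk; apply/up0/ltnW.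
have uplast r j : j.+1 = k -> up r j = 0.
  move=> jk; rewrite /up; case: ifP => // /andP[v v'].
  by rewrite /A jk !divff ?subrr// gt_eqF.
(* The mass at coordinate [p.2] is shared equally by the points of one level of [Q]; [f] already
   contains the factor [1 / W]. *)
pose g (p q : Q * 'I_k) : K :=
  let r := (prod_rk rk p)%:Z in
  (q.2 == p.2 :> nat)%:R * (stay r p.2 * f p.1 q.1) +
  (q.2 == p.2.+1 :> nat)%:R * ((q.1 == p.1)%:R * (up r p.2 / W (rk p.1))).
have rkE p : (prod_rk rk p)%:Z - p.2%:Z = rk p.1 by rewrite /prod_rk; lia.
exists g; split.
- move=> p q; rewrite /g addr_ge0//.
    by rewrite !mulr_ge0// ?ler0n ?stay0.
  by rewrite !mulr_ge0// ?ler0n ?up0// ?invr_ge0 ?W0.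
- move=> p q; rewrite /g /prod_le /prod_rk => gn0.
  have [e1|e1] := eqVneq (q.2 : nat) p.2.
    move: gn0; rewrite e1 eqxx -[X in _ + X * _]/((p.2 == p.2.+1 :> nat)%:R).
    rewrite (_ : (p.2 == p.2.+1 :> nat) = false) ?mul0r ?addr0 ?mul1r; last by lia.
    by rewrite mulf_eq0 negb_or => /andP[_ /fle[-> ->]]; rewrite leqnn addSn.
  move: gn0; rewrite (negbTE e1) mul0r add0r.
  have [->|_] := eqVneq (q.2 : nat) p.2.+1; last by rewrite mul0r eqxx.
  have [->|_] := eqVneq q.1 p.1; last by rewrite mul0r mulr0 eqxx.
  by rewrite lexx leqnSn addnS.
- move=> p; rewrite !level_size_prod -/W => V1.
  set r := (prod_rk rk p)%:Z.
  have fr : full r.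
    by rewrite /full V1 andbT /V -level_size_prod level_size_gt0.
  have Wx : 0 < W (rk p.1) by exact: level_size_gt0.
  transitivity ((stay r p.2 + up r p.2) / W (rk p.1)); last first.
    by rewrite outE// rkE mulrAC divff ?gt_eqF// mul1r.
  rewrite mulrDl /g big_split /= -/r; congr (_ + _).
    rewrite -(pair_bigA _ (fun x (j : 'I_k) =>
      (j == p.2 :> nat)%:R * (stay r p.2 * f p.1 x))) /=.
    under eq_bigr do rewrite sum_ord_delta ltn_ord.
    (* If the next level of [Q] is empty, [fout] says nothing; but then by [inE] no mass stays. *)
    rewrite -mulr_sumr; have [Wy|Wy] := ltP 0 (W ((rk p.1)%:Z + 1)).
      by rewrite fout.
    rewrite (_ : stay r p.2 = 0) ?mul0r//.
    apply/eqP; rewrite eq_le stay0// andbT.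
    rewrite -(lerD2r (into r p.2)) inE// add0r (le_trans _ (into0 _ _ _))//.
    have <- : (rk p.1)%:Z + 1 = r + 1 - p.2%:Z by rewrite -rkE -/r; ring.
    by rewrite pmulr_lle0// invr_gt0; case/andP: fr.
  rewrite -(pair_bigA _ (fun x (j : 'I_k) => (j == p.2.+1 :> nat)%:R *
     ((x == p.1)%:R * (up r p.2 / W (rk p.1))))) /=.
  under eq_bigr do rewrite sum_ord_delta.
  have [jk|jk] := ltnP p.2.+1 k; first by rewrite sum_delta.
  by rewrite big1_eq uplast ?mul0r//; apply/eqP; rewrite eqn_leq ltn_ord.
- move=> q; rewrite !level_size_prod -/W => V1.
  set r := (prod_rk rk q)%:Z - 1 in V1.
  have rE : (prod_rk rk q)%:Z = r + 1 by rewrite /r subrK.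
  have fr : full r.
    by rewrite /full V1 -rE /V -level_size_prod level_size_gt0.
  have Wx : 0 < W (rk q.1) by exact: level_size_gt0.
  transitivity ((stay r q.2 + into r q.2) / W (rk q.1)); last first.
    by rewrite inE// -rE rkE mulrAC divff ?gt_eqF// mul1r.
  rewrite mulrDl /g big_split /=; congr (_ + _).
    transitivity (\sum_x \sum_(j < k) (j == q.2 :> nat)%:R * (stay r q.2 * f x q.1)).
      rewrite pair_bigA /=; apply: eq_bigr => -[x j] _ /=; rewrite [in LHS]eq_sym.
      case: eqP => [e|_]; last by rewrite !mul0r.
      have [->|/fle[_ e']] := eqVneq (f x q.1) 0; first by rewrite !mulr0.
      by rewrite e; do 2![congr (_ * _)]; congr stay; rewrite /r /prod_rk e' /=; lia.
    under eq_bigr do rewrite sum_ord_delta ltn_ord.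
    rewrite -mulr_sumr; have [Wy|Wy] := ltP 0 (W ((rk q.1)%:Z - 1)).
      by rewrite fin.
    rewrite (_ : stay r q.2 = 0) ?mul0r//.
    apply/eqP; rewrite eq_le stay0// andbT.
    rewrite -(lerD2r (up r q.2)) outE// add0r (le_trans _ (up0 _ _ _))//.
    have <- : (rk q.1)%:Z - 1 = r - q.2%:Z by rewrite -rkE /r; ring.
    by rewrite pmulr_lle0// invr_gt0; case/andP: fr.
  transitivity (\sum_x \sum_(j < k) (q.2 == j.+1 :> nat)%:R *
     ((x == q.1)%:R * (into r q.2 / W (rk q.1)))).
    rewrite pair_bigA /=; apply: eq_bigr => -[x j] _ /=.
    case: eqP => [e|_]; last by rewrite !mul0r.
    rewrite [in LHS]eq_sym; have [->|_] := eqVneq x q.1; last by rewrite !mul0r.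
    rewrite e /=; do 2![congr (_ * _)]; congr (up _ _ / _).
    by rewrite /r /prod_rk e /=; lia.
  rewrite exchange_big; under eq_bigr do rewrite -mulr_sumr sum_delta.
  case E: (q.2 : nat) => [|j] /=.
    by rewrite big1 ?mul0r// => i _; rewrite mul0r.
  transitivity (\sum_(i < k) (i == j :> nat)%:R * (up r j / W (rk q.1))).
    by apply: eq_bigr => i _; rewrite eqSS eq_sym.
  by rewrite sum_ord_delta (_ : (j < k)%N)//; have := ltn_ord q.2; lia.
Qed.
End RankedPosets.

(** * Fractional chain covers *)

Section ChainCovers.
Import Order.TTheory GRing.Theory Num.Theory.
Local Open Scope ring_scope.
Variable K : realFieldType.
Notation level_size := (@level_size K).

(* [p w] is a random saturated chain, drawn with probability [mu w], whose
   element at each level is uniform there. *)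
Lemma uniform_random_chain (Q : finType) (le : rel Q) (rk : Q -> nat)
    (f : Q -> Q -> K) (r : nat) :
  log_concave (level_size rk) -> normalized_flow le rk f ->
  0 < level_size rk 0 -> 0 < level_size rk r ->
  exists (Om : finType) (mu : Om -> K) (p : Om -> nat -> Q),
    [/\ forall w, 0 <= mu w,
        forall w i, mu w != 0 -> (i <= r)%N -> rk (p w i) = i,
        forall w i, mu w != 0 -> (i < r)%N -> le (p w i) (p w i.+1) &
        forall x, (rk x <= r)%N ->
          \sum_w mu w * (p w (rk x) == x)%:R = (level_size rk (rk x))^-1].
Proof.
move=> lcW [f0 fle fout fin] W00; elim: r => [|r IH] Wr.
  exists Q, (fun x => (rk x == 0)%:R / level_size rk 0), (fun x _ => x); split => //.
  - by move=> x; rewrite divr_ge0 ?ler0n// ltW.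
  - move=> x i; rewrite mulf_eq0 negb_or pnatr_eq0 eqb0 negbK.
    by rewrite leqn0 => /andP[/eqP-> _] /eqP->.
  - move=> x; rewrite leqn0 => /eqP x0.
    under eq_bigr do rewrite mulrC.
    by rewrite sum_delta x0 eqxx mul1r.
have W0 z : 0 <= level_size rk z by exact: level_size_ge0.
(* Log-concavity leaves no gap: [W 0 * W (r + 1) <= W 1 * W r]. *)
have Wr' : 0 < level_size rk r.
  rewrite lt_neqAle W0 andbT; apply: contraTneq Wr => Wr0.
  have := lcW 0 1 r r.+1; rewrite -Wr0 mulr0 => /(_ isT isT _).
  by rewrite pmulr_rle0// -leNgt; apply; lia.
have [Om [mu [p [mu0 prk ple pu]]]] := IH Wr'.
pose W := level_size rk r.
have step w : mu w != 0 -> W * \sum_y f (p w r) y = 1.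
  move=> wn0; have e := prk w r wn0 (leqnn r).
  have e1 : (rk (p w r))%:Z + 1 = r.+1 by lia.
  by rewrite fout ?e1// e divff// gt_eqF.
(* A Markov step: given the end [p w r] of the chain, the next point is [y] with probability
   [W * f (p w r) y]. *)
exists (Om * Q)%type, (fun wy => mu wy.1 * (W * f (p wy.1 r) wy.2)),
  (fun wy i => if (i <= r)%N then p wy.1 i else wy.2).
have fn0 w y : mu w * (W * f (p w r) y) != 0 -> mu w != 0 /\ f (p w r) y != 0.
  by rewrite !mulf_eq0 !negb_or => /andP[-> /andP[_ ->]].
split => /=.
- by move=> [w y]; rewrite !mulr_ge0 ?W0 ?f0 ?mu0.
- move=> [w y] i /= /fn0[wn0 fn] ir; case: leqP => ri; first exact: prk.
  by have [_ ->] := fle _ _ fn; rewrite prk//; lia.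
- move=> [w y] i /= /fn0[wn0 fn]; rewrite ltnS => ir; rewrite ir.
  case: ltnP => ri; first exact: ple.
  by have -> : i = r by [lia]; have [] := fle _ _ fn.
move=> x; rewrite leq_eqVlt ltnS => /predU1P[xr|xr].
  rewrite xr ltnn -(pair_bigA _ (fun w y => mu w * (W * f (p w r) y) * (y == x)%:R)) /=.
  under eq_bigr do under eq_bigr do rewrite mulrC.
  under eq_bigr do rewrite sum_delta.
  transitivity (\sum_w \sum_u (u == p w r)%:R * (mu w * (W * f u x))).
    by apply: eq_bigr => w _; rewrite sum_delta.
  rewrite exchange_big /=.
  have xr1 : (rk x)%:Z - 1 = r by lia.
  rewrite -xr -fin ?xr1//; apply: eq_bigr => u _.
  have [->|fn] := eqVneq (f u x) 0; first by rewrite big1 // => w _; rewrite !mulr0.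
  have ur : rk u = r by have [_] := fle _ _ fn; lia.
  under eq_bigr do rewrite mulrA [_ * mu _]mulrC eq_sym.
  have := pu u; rewrite ur leqnn -mulr_suml => ->//.
  by rewrite mulrA mulVf ?mul1r// gt_eqF.
rewrite xr -pu// -(pair_bigA _ (fun w y => mu w * (W * f (p w r) y) * (p w (rk x) == x)%:R)) /=.
apply: eq_bigr => w _; have [->|wn0] := eqVneq (mu w) 0.
  by rewrite mul0r big1// => y _; rewrite !mul0r.
by rewrite -mulr_suml -mulr_sumr -mulr_sumr step// mulr1.
Qed.

(** Used in both roles of [m] and [T]: once for progressions of difference [T], once for blocks of
    [m] copies. *)
Lemma sum_divn_modn (m T : nat) (F : nat -> K) :
  \sum_(0 <= z < m * T) F z = \sum_(j < m) \sum_(t < T) F (t + j * T)%N.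
Proof.
elim: m => [|m IH]; first by rewrite mul0n big_nil big_ord0.
rewrite big_ord_recr /= -IH mulSn addnC (@big_cat_nat _ _ _ (m * T)) ?leq_addr//=.
congr (_ + _); have := @big_addn _ 0 +%R 0 (m * T + T) (m * T) xpredT F.
by rewrite add0n addKn big_mkord.
Qed.

(** Everything between two equal entries agrees with them. Hence, if no value occurs more than [h]
    times, positions at least [h] apart hold different values. *)
Lemma count_sorted_plateau (s : seq nat) (a b : nat) :
  sorted leq s -> (a <= b < size s)%N -> nth 0%N s a = nth 0%N s b ->
  (b - a < count_mem (nth 0%N s a) s)%N.
Proof.
move=> ss /andP[ab bs] eab.
have eq i : (a <= i <= b)%N -> nth 0%N s i = nth 0%N s a.
  move=> /andP[ai ib]; apply/eqP; rewrite eqn_leq {1}eab.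
  by rewrite !(sorted_leq_nth leq_trans leqnn 0%N ss)// inE; lia.
rewrite -sum1_count (big_nth 0%N) (@big_cat_nat _ _ _ a)//=; last by lia.
rewrite (@big_cat_nat _ _ _ b.+1 a)//=; last by lia.
rewrite [X in (_ + (X + _))%N](_ : _ = (b.+1 - a)%N); first by lia.
rewrite big_mkcond (eq_big_nat _ _ (F2 := fun=> 1%N)) ?sum_nat_const_nat ?muln1//.
by move=> i abi; rewrite eq ?eqxx//; lia.
Qed.

(** The chain condition is an equivalence, so that products of chains of nonzero weight transport
    induced copies too. *)
Definition fractional_chain_cover (Q : finType) (le : rel Q) (m : nat) :=
  exists (Om : finType) (lam : Om -> K) (c : Om -> 'I_m -> Q),
    [/\ forall w, 0 <= lam w,
        forall w, lam w != 0 -> forall i j, le (c w i) (c w j) = (i <= j)%N &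
        forall x, \sum_w \sum_(j < m) lam w * (c w j == x)%:R = 1].

(* List the elements of [Q] by increasing rank and blow each up to [m] copies:
   a level of size at most [#|Q| / m] then meets every progression of
   difference [#|Q|] at most once, so that the ranks of its [m] terms are
   distinct.  Along a random chain these ranks select an [m]-element chain. *)
Lemma fractional_chain_cover_of_flow (Q : finType) (le : rel Q) (rk : Q -> nat)
    (f : Q -> Q -> K) (m h : nat) :
  reflexive le -> transitive le -> (forall x y, le x y -> (rk x <= rk y)%N) ->
  log_concave (level_size rk) -> normalized_flow le rk f ->
  0 < level_size rk 0 -> (forall z, level_size rk z <= h%:R) ->
  (0 < m)%N -> (m * h <= #|Q|)%N -> fractional_chain_cover le m.
Proof.
move=> lexx letr lerk lcW ff W00 Wh m0 mhT; set T := #|Q| in mhT.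
pose s := sort leq [seq rk x | x <- enum Q].
have sizes : size s = T by rewrite size_sort size_map -cardE.
have ss : sorted leq s by apply: sort_sorted; exact: leq_total.
have cs r : (count_mem r s)%:R = level_size rk r.
  rewrite (permP (permEl (perm_sort leq _))) count_map -sum1_count big_enum_cond /=.
  by rewrite big_mkcond natr_sum /level_size; apply: eq_bigr => x _; rewrite eqz_nat; case: eqP.
have T0 : (0 < T)%N.
  rewrite lt0n; apply: contraTneq W00 => T0; rewrite /level_size big1 ?ltxx// => x _.
  by have := fintype0 x T0.
pose l z := nth 0%N s (z %/ m).
pose r := \max_x rk x.
have lr z : (z < m * T)%N -> (l z <= r)%N.
  move=> zmT; have : l z \in s by rewrite mem_nth// sizes ltn_divLR// mulnC.
  by rewrite mem_sort => /mapP[x _ ->]; exact: leq_bigmax.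
have Wr : 0 < level_size rk r.
  by rewrite /r; have [x ->] := bigop.eq_bigmax rk T0; exact: level_size_gt0.
have zmT (t : 'I_T) (j : 'I_m) : (t + j * T < m * T)%N.
  by have := ltn_ord t; have := ltn_ord j; nia.
have [Om [mu [p [mu0 prk ple pu]]]] := uniform_random_chain lcW ff W00 Wr.
have pmono w i j : mu w != 0 -> (i <= j <= r)%N -> le (p w i) (p w j).
  move=> wn0 /andP[/subnKC <-]; elim: (j - i)%N => [|n IH]; first by rewrite addn0.
  by rewrite addnS => ijr; apply: letr (IH _) (ple _ _ wn0 ijr); exact: ltnW.
have lmono (t : 'I_T) (i j : 'I_m) : (i < j)%N -> (l (t + i * T) < l (t + j * T))%N.
  move=> ij; set a := (t + i * T)%N; set b := (t + j * T)%N.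
  (* A shift by [T >= m * h] in the blown-up list advances at least [h] entries of [s]. *)
  have hab : (a %/ m + h <= b %/ m)%N.
    rewrite leq_divRL// mulnDl; have := leq_trunc_div a m.
    by rewrite /a /b; nia.
  have bT : (b %/ m < T)%N by rewrite ltn_divLR// mulnC zmT.
  rewrite ltn_neqAle (sorted_leq_nth leq_trans leqnn 0%N ss) ?inE ?sizes; try lia.
  rewrite andbT; apply: contraTneq isT => lab.
  have := @count_sorted_plateau s (a %/ m) (b %/ m) ss.
  rewrite sizes bT andbT => /(_ _ lab); have := Wh (l a).
  by rewrite -cs ler_nat /l; lia.
(* Every position is [t + j * T] exactly once. The rank of [x] occupies [W * m] positions, and at
   each the chain hits [x] with probability [1 / W]; weight [mu / m] thus covers [x] exactly
   once. *)
exists (Om * 'I_T)%type, (fun wt => mu wt.1 / m%:R),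
  (fun (wt : Om * 'I_T) (j : 'I_m) => p wt.1 (l (wt.2 + j * T)%N)).
split.
- by move=> w; rewrite divr_ge0 ?ler0n.
- move=> [w t] /=; rewrite mulf_eq0 negb_or => /andP[wn0 _] i j.
  case: leqP => ij.
    apply: pmono => //; rewrite lr ?zmT// andbT.
    by move: ij; rewrite leq_eqVlt => /predU1P[->//|/lmono/ltnW].
  apply/negP => /lerk; rewrite !prk ?lr ?zmT//.
  by have := lmono t _ _ ij; lia.
move=> x; set W := level_size rk (rk x).
have W0 : 0 < W by exact: level_size_gt0.
rewrite -(pair_bigA _ (fun w (t : 'I_T) => \sum_(j < m) mu w / m%:R * (p w (l (t + j * T)%N) == x)%:R)) /=.
have key (t : 'I_T) (j : 'I_m) : \sum_w mu w / m%:R * (p w (l (t + j * T)%N) == x)%:R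
    = (l (t + j * T)%N == rk x)%:R / (W * m%:R).
  under eq_bigr do rewrite mulrAC.
  rewrite -mulr_suml invfM mulrA; congr (_ / _); case: eqP => [->|ne].
    by rewrite mul1r pu// leq_bigmax.
  rewrite mul0r big1// => w _; have [->|wn0] := eqVneq (mu w) 0; first by rewrite mul0r.
  case: eqP => [e|_]; last by rewrite mulr0.
  by case: ne; rewrite -e prk ?lr ?zmT.
rewrite exchange_big /=; under eq_bigr do rewrite exchange_big /=.
rewrite exchange_big /=.
under eq_bigr do under eq_bigr do rewrite key.
under eq_bigr do rewrite -mulr_suml.
rewrite -mulr_suml -(sum_divn_modn m T (fun z => (l z == rk x)%:R)).
rewrite mulnC sum_divn_modn -[X in X = _]/(_ / _).
have -> : \sum_(j < T) \sum_(t < m) (l (t + j * m)%N == rk x)%:R = W * m%:R :> K.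
  transitivity (\sum_(i < T) (nth 0%N s i == rk x)%:R * m%:R : K).
    apply: eq_bigr => i _; rewrite (eq_bigr (fun=> (nth 0%N s i == rk x)%:R)).
      by rewrite sumr_const card_ord -[LHS]mulr_natr.
    by move=> t _; rewrite /l addnC divnMDl// divn_small ?addn0.
  rewrite -mulr_suml /W -cs -sum1_count (big_nth 0%N) sizes big_mkord natr_sum.
  by rewrite [in RHS]big_mkcond; congr (_ * _); apply: eq_bigr => i _ /=; case: eqP.
by rewrite divff// mulf_neq0 ?gt_eqF ?ltr0n.
Qed.
End ChainCovers.

(** * Largest level and second moment *)

Section LevelBounds.
Import Order.TTheory GRing.Theory Num.Theory.
Local Open Scope ring_scope.
Variable K : realFieldType.
Notation level_size := (@level_size K).

(** Both sides sum [g a * u s] over [a <= s < B]. *)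
Lemma sum_tails (B : nat) (g u : nat -> K) :
  \sum_(a < B) g a * \sum_(i < B - a) u (a + i)%N =
  \sum_(s < B) (\sum_(a < s.+1) g a) * u s.
Proof.
elim: B => [|B IH]; first by rewrite !big_ord0.
rewrite big_ord_recr [RHS]big_ord_recr -IH /= subSnn big_ord1 addn0.
rewrite [\sum_(a < B.+1) g a]big_ord_recr /= mulrDl addrA; congr (_ + _).
rewrite mulr_suml -big_split /=; apply: eq_bigr => a _.
by rewrite subSn ?big_ord_recr/= ?subnKC ?mulrDr// ltnW.
Qed.

(* Two rounds of [u 0 * u (a + i) <= u a * u i], each comparing a tail of [u]
   with the whole sum. *)
Lemma second_moment_submultiplicative (B : nat) (u : nat -> K) :
  (forall a, 0 <= u a) -> (forall a i, u 0%N * u (a + i)%N <= u a * u i) ->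
  u 0%N ^+ 2 * \sum_(s < B) s%:R ^+ 2 * u s <= 2 * (\sum_(s < B) u s) ^+ 3.
Proof.
move=> u0 usub; set S := \sum_(s < B) u s.
pose tail a := \sum_(i < B - a) u (a + i)%N.
have S0 : 0 <= S by exact: sumr_ge0.
have tailS (a : 'I_B) : u 0%N * tail a <= u a * S.
  have -> : S = \sum_(i < B - a) u i + \sum_(B - a <= i < B) u i.
    by rewrite /S -!(big_mkord xpredT) -big_cat_nat//= leq_subr.
  rewrite mulrDr -[leLHS]addr0 lerD//; last first.
    by rewrite mulr_ge0// sumr_ge0.
  by rewrite /tail !mulr_sumr; apply: ler_sum => i _.
(* One round: replacing [g] by its prefix sums costs a factor [S / u 0]. Two rounds from [g = 1]
   reach the triangular numbers, which dominate [s ^ 2 / 2]. *)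
have weighted (g : nat -> K) : (forall a, 0 <= g a) ->
    u 0%N * \sum_(s < B) (\sum_(a < s.+1) g a) * u s <= S * \sum_(s < B) g s * u s.
  move=> g0; rewrite -sum_tails -/tail mulr_sumr [S * _]mulr_sumr.
  apply: ler_sum => a _; rewrite mulrCA [S * _]mulrC -mulrA ler_wpM2l//; exact: tailS.
have h1 := weighted (fun=> 1) (fun=> ler01).
have h2 := weighted (fun a => a.+1%:R) (fun a => ler0n _ _).
have e1 : \sum_(s < B) (\sum_(a < s.+1) 1) * u s = \sum_(s < B) s.+1%:R * u s.
  by apply: eq_bigr => s _; rewrite sumr_const card_ord.
have e2 : \sum_(s < B) 1 * u s = S by apply: eq_bigr => s _; rewrite mul1r.
have tri (s : nat) : s%:R ^+ 2 <= 2 * \sum_(a < s.+1) (a.+1%:R : K).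
  elim: s => [|s IH]; first by rewrite big_ord1 expr0n /=; lra.
  have s0 : 0 <= s%:R :> K by exact: ler0n.
  by rewrite big_ord_recr /= -!natr1; nra.
have h3 : \sum_(s < B) s%:R ^+ 2 * u s <=
    2 * \sum_(s < B) (\sum_(a < s.+1) a.+1%:R) * u s.
  by rewrite mulr_sumr; apply: ler_sum => s _; rewrite mulrA ler_wpM2r.
rewrite e1 e2 in h1.
have := ler_wpM2l (sqr_ge0 (u 0%N)) h3.
have := ler_wpM2l (u0 0%N) h2; have := ler_wpM2l S0 h1.
set X1 := \sum_(s < B) s.+1%:R * u s; set X2 := \sum_(s < B) _ * u s.
lra.
Qed.

(** The level sizes read from [M] in direction [e] satisfy the submultiplicativity above by
    log-concavity, and their sum is at most [#|Q|]. *)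
Lemma second_moment_half (Q : finType) (rk : Q -> nat) (B : nat) (M e : int) :
  log_concave (level_size rk) -> `|e| = 1 ->
  level_size rk M ^+ 2 * \sum_(s < B) s%:R ^+ 2 * level_size rk (M + e * s%:Z)
    <= 2 * #|Q|%:R ^+ 3.
Proof.
move=> lcW e1; pose u (a : nat) := level_size rk (M + e * a%:Z).
have u0 a : 0 <= u a by exact: level_size_ge0.
have usub a i : u 0%N * u (a + i)%N <= u a * u i.
  rewrite /u; case: (ltP 0 e) => e0.
    have -> : e = 1 by lia.
    by apply: lcW; lia.
  have -> : e = -1 by lia.
  by rewrite mulrC; apply: lcW; lia.
have := second_moment_submultiplicative B u0 usub.
rewrite {1}/u mulr0 addr0 => /le_trans; apply.
rewrite ler_pM2l// lerXn2r ?nnegrE ?sumr_ge0//.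
rewrite /u /level_size exchange_big -sum1_card natr_sum; apply: ler_sum => x _.
apply: (@le_trans _ _ (\sum_(a < B) (a == `|(rk x)%:Z - M|%N :> nat)%:R * 1)).
  by apply: ler_sum => a _; rewrite mulr1 ler_nat; do 2![case: eqP => //]; lia.
by rewrite sum_ord_delta; case: ifP.
Qed.

Lemma second_moment_mode (Q : finType) (rk : Q -> nat) (M : int) :
  log_concave (level_size rk) ->
  level_size rk M ^+ 2 * \sum_x ((rk x)%:Z - M)%:~R ^+ 2 <= 4 * #|Q|%:R ^+ 3.
Proof.
move=> lcW; pose B := (\max_x `|(rk x)%:Z - M|%N).+1.
have h1 := @second_moment_half Q rk B M 1 lcW erefl.
have h2 := @second_moment_half Q rk B M (-1) lcW erefl.
suff : \sum_x ((rk x)%:Z - M)%:~R ^+ 2 <=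
    \sum_(s < B) s%:R ^+ 2 * level_size rk (M + 1 * s%:Z) +
    \sum_(s < B) s%:R ^+ 2 * level_size rk (M + -1 * s%:Z).
  by move=> /(ler_wpM2l (sqr_ge0 (level_size rk M))); lra.
rewrite -big_split /=.
have -> : \sum_(s < B) (s%:R ^+ 2 * level_size rk (M + 1 * s%:Z) +
      s%:R ^+ 2 * level_size rk (M + -1 * s%:Z)) =
    \sum_x \sum_(s < B) s%:R ^+ 2 * (((rk x)%:Z == M + 1 * s%:Z)%:R +
      ((rk x)%:Z == M + -1 * s%:Z)%:R).
  rewrite exchange_big; apply: eq_bigr => s _.
  by rewrite -mulrDr /level_size -big_split mulr_sumr.
apply: ler_sum => x _; set d := `|(rk x)%:Z - M|%N.
have dB : (d < B)%N by rewrite ltnS /d (bigop.leq_bigmax x).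
rewrite (bigD1 (Ordinal dB))//= -[leLHS]addr0 lerD//; last first.
  by apply: sumr_ge0 => s _; rewrite mulr_ge0 ?addr_ge0 ?ler0n ?sqr_ge0.
have -> : ((rk x)%:Z - M)%:~R ^+ 2 = d%:R ^+ 2 :> K.
  by rewrite /d natr_absz intr_norm real_normK ?num_real.
rewrite -[leLHS]mulr1 ler_wpM2l ?sqr_ge0// -natrD ler1n.
by do 2![case: eqP => //=]; rewrite /d; lia.
Qed.
End LevelBounds.

(** * The grid *)

Section Grids.
Import Order.TTheory GRing.Theory Num.Theory.
Local Open Scope ring_scope.
Variable K : realFieldType.
Notation level_size := (@level_size K).

Definition grid_rank n k (x : grid n k) : nat := (\sum_i x i)%N.

Definition grid_cons n k (p : grid n k * 'I_k) : grid n.+1 k :=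
  [ffun i => if unlift ord0 i is Some j then p.1 j else p.2].

Definition grid_uncons n k (x : grid n.+1 k) : grid n k * 'I_k :=
  ([ffun i => x (lift ord0 i)], x ord0).

Lemma grid_consK n k : cancel (@grid_cons n k) (@grid_uncons n k).
Proof.
move=> [x j]; rewrite /grid_uncons !ffunE unlift_none; congr (_, _).
by apply/ffunP => i; rewrite !ffunE liftK.
Qed.

Lemma grid_unconsK n k : cancel (@grid_uncons n k) (@grid_cons n k).
Proof. by move=> x; apply/ffunP => i; rewrite ffunE; case: unliftP => [j|] ->//=; rewrite ffunE. Qed.

Lemma grid_rank_cons n k (p : grid n k * 'I_k) :
  grid_rank (grid_cons p) = prod_rk (@grid_rank n k) p.
Proof.
rewrite /grid_rank big_ord_recl !ffunE unlift_none /prod_rk addnC; congr addn.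
by apply: eq_bigr => i _; rewrite ffunE liftK.
Qed.

Lemma grid_le_cons n k (p q : grid n k * 'I_k) :
  grid_le (grid_cons p) (grid_cons q) = prod_le (@grid_le n k) p q.
Proof.
apply/forallP/andP => [h|[/forallP h1 h2] i].
  split; last by have := h ord0; rewrite !ffunE unlift_none.
  by apply/forallP => i; have := h (lift ord0 i); rewrite !ffunE liftK.
by rewrite !ffunE; case: unliftP => [j|] _.
Qed.

Lemma sum_grid_cons n k (F : grid n.+1 k -> K) :
  \sum_x F x = \sum_x \sum_(j < k) F (grid_cons (x, j)).
Proof.
rewrite (reindex (@grid_cons n k)) /=; last first.
  by exists (@grid_uncons n k) => x _; rewrite ?grid_consK ?grid_unconsK.
by rewrite pair_bigA /=; apply: eq_bigr => -[x j].
Qed.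

Lemma grid_le_refl n k : reflexive (@grid_le n k).
Proof. by move=> x; apply/forallP => i. Qed.

Lemma grid_le_trans n k : transitive (@grid_le n k).
Proof.
by move=> y x z /forallP xy /forallP yz; apply/forallP => i; exact: leq_trans (xy i) (yz i).
Qed.

Lemma grid_le_rank n k (x y : grid n k) :
  grid_le x y -> (grid_rank x <= grid_rank y)%N.
Proof. by move=> /forallP xy; apply: leq_sum. Qed.

Lemma grid_le_rank_eq n k (x y : grid n k) :
  grid_le x y -> grid_rank x = grid_rank y -> x = y.
Proof.
move=> /forallP xy exy; apply/ffunP => i; apply: val_inj; apply/eqP.
have := leqif_sum (fun (i : 'I_n) (_ : true) => leqif_eq (xy i)).
by case=> _; rewrite -/(grid_rank x) exy eqxx => /esym/forallP/(_ i).
Qed.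

Lemma level_size_grid0 k z : level_size (@grid_rank 0 k) z = (z == 0)%:R.
Proof.
have x0 : grid 0 k by apply: finfun; case.
rewrite /level_size (big_pred1 x0) => [|x]; first by rewrite /grid_rank big_ord0 eq_sym.
by rewrite /= (_ : x = x0) ?eqxx//; apply/ffunP => -[].
Qed.

Lemma level_size_grid_cons n k z :
  level_size (@grid_rank n.+1 k) z = window (level_size (@grid_rank n k)) z k.
Proof.
rewrite -level_size_prod /level_size sum_grid_cons pair_bigA /=.
by apply: eq_bigr => p _; rewrite -surjective_pairing grid_rank_cons.
Qed.

Lemma log_concave_grid n k : log_concave (level_size (@grid_rank n k)).
Proof.
elim: n => [|n IH] a b c e ab ac abce.
  by rewrite !level_size_grid0 -!natrM ler_nat; do 4![case: eqP => //=]; lia.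
by rewrite !level_size_grid_cons; exact: (log_concave_window k IH).
Qed.

Lemma normalized_flow_grid n k :
  exists f : _ -> _ -> K, normalized_flow (@grid_le n k) (@grid_rank n k) f.
Proof.
elim: n => [|n [f ff]].
  exists (fun _ _ => 0); split => //= x; first by rewrite eqxx.
  - by rewrite level_size_grid0 /grid_rank big_ord0 ltxx.
  - by rewrite level_size_grid0 /grid_rank big_ord0 ltxx.
have [g [g0 gle gout gin]] :=
  normalized_flow_prod k (@grid_le_refl n k) (@log_concave_grid n k) ff.
have lev z : level_size (@grid_rank n.+1 k) z = level_size (prod_rk (@grid_rank n k) (k := k)) z.
  by rewrite level_size_grid_cons level_size_prod.
have rkE (x : grid n.+1 k) : grid_rank x = prod_rk (@grid_rank n k) (grid_uncons x).
  by rewrite -grid_rank_cons grid_unconsK.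
exists (fun x y => g (grid_uncons x) (grid_uncons y)); split => //.
- move=> x y /gle; rewrite -grid_le_cons !grid_unconsK => -[->].
  by rewrite !rkE.
- move=> x; rewrite !lev rkE => /gout <-; rewrite sum_grid_cons pair_bigA /=.
  by apply: eq_bigr => p _; rewrite -surjective_pairing grid_consK.
- move=> x; rewrite !lev rkE => /gin <-; rewrite sum_grid_cons pair_bigA /=.
  by apply: eq_bigr => p _; rewrite -surjective_pairing grid_consK.
Qed.

Lemma card_grid n k : #|{: grid n k}| = (k ^ n)%N.
Proof. by rewrite card_ffun !card_ord. Qed.

Definition dev n k (x : grid n k) : K := 2 * (grid_rank x)%:R - n%:R * (k%:R - 1).

Lemma dev_cons n k (x : grid n k) (j : 'I_k) :
  dev (grid_cons (x, j)) = dev x + (2 * j%:R - (k%:R - 1)).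
Proof. by rewrite /dev grid_rank_cons /prod_rk natrD -natr1 /=; ring. Qed.

Lemma sum_affine (k : nat) (c : K) :
  \sum_(j < k) (2 * j%:R - c) = k%:R * (k%:R - 1 - c).
Proof.
elim: k => [|k IH]; first by rewrite big_ord0 mul0r.
by rewrite big_ord_recr IH -natr1 /=; ring.
Qed.

Lemma sum_affine_sq (k : nat) (c : K) :
  3 * \sum_(j < k) (2 * j%:R - c) ^+ 2 =
  2 * (k%:R - 1) * k%:R * (2 * k%:R - 1) - 6 * c * k%:R * (k%:R - 1) + 3 * k%:R * c ^+ 2.
Proof.
elim: k => [|k IH]; first by rewrite big_ord0; ring.
by rewrite big_ord_recr mulrDr IH -natr1 /=; ring.
Qed.

Lemma sum_dev n k : \sum_(x : grid n k) dev x = 0.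
Proof.
elim: n => [|n IH].
  by rewrite big1// => x _; rewrite /dev /grid_rank big_ord0; ring.
rewrite sum_grid_cons; under eq_bigr do under eq_bigr do rewrite dev_cons.
under eq_bigr do rewrite big_split sumr_const /= sum_affine subrr mulr0 addr0.
by rewrite sumrMnl IH mul0rn.
Qed.

Lemma sum_dev_sq n k :
  3 * \sum_(x : grid n k) dev x ^+ 2 = (k ^ n)%:R * n%:R * (k%:R ^+ 2 - 1).
Proof.
elim: n => [|n IH].
  rewrite mulr0 mul0r big1 ?mulr0// => x _; rewrite /dev /grid_rank big_ord0.
  by ring.
pose c : K := k%:R - 1; pose X := \sum_(j < k) (2 * j%:R - c) ^+ 2.
have fiber (x : grid n k) :
    \sum_(j < k) dev (grid_cons (x, j)) ^+ 2 = k%:R * dev x ^+ 2 + X.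
  transitivity (\sum_(j < k) (dev x ^+ 2 + 2 * dev x * (2 * j%:R - c) + (2 * j%:R - c) ^+ 2)).
    by apply: eq_bigr => j _; rewrite dev_cons -/c; ring.
  rewrite !big_split /= -[\sum_(i < k) 2 * dev x * _]mulr_sumr sum_affine subrr !mulr0 addr0.
  by rewrite sumr_const card_ord mulr_natl.
rewrite sum_grid_cons; under eq_bigr do rewrite fiber.
rewrite big_split /= -mulr_sumr sumr_const -[X *+ _]mulr_natl card_grid.
rewrite mulrDr mulrCA IH [3 * _]mulrCA /X sum_affine_sq /c expnS natrM -natr1.
by ring.
Qed.

Lemma level_size_grid_ub n k (M : int) : (2 <= k)%N ->
  level_size (@grid_rank n k) M ^+ 2 * (n%:R * k%:R ^+ 2) <= 64 * (k ^ n)%:R ^+ 2.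
Proof.
move=> k2; set W := level_size _ _; set T : K := (k ^ n)%:R.
have T0 : 0 < T by rewrite ltr0n expn_gt0; lia.
have := second_moment_mode M (@log_concave_grid n k).
rewrite -/W card_grid -/T => h.
have hs : \sum_(x : grid n k) dev x ^+ 2 <=
    4 * \sum_(x : grid n k) ((grid_rank x)%:Z - M)%:~R ^+ 2.
  pose dl : K := 2 * M%:~R - n%:R * (k%:R - 1).
  have -> : 4 * \sum_(x : grid n k) ((grid_rank x)%:Z - M)%:~R ^+ 2 =
      \sum_(x : grid n k) dev x ^+ 2 + T * dl ^+ 2.
    transitivity (\sum_(x : grid n k) (dev x ^+ 2 - 2 * dl * dev x + dl ^+ 2)).
      rewrite mulr_sumr; apply: eq_bigr => x _; rewrite intrB /dev /dl.
      by rewrite -pmulrn; ring.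
    rewrite !big_split /= sumrN -mulr_sumr sum_dev mulr0 subr0 sumr_const card_grid.
    by rewrite -[X in _ + X]mulr_natl.
  by rewrite lerDl mulr_ge0 ?sqr_ge0// ltW.
have k2' : 2 <= k%:R :> K by rewrite (ler_nat K 2).
have hv := sum_dev_sq n k; rewrite -/T in hv.
have W0 : 0 <= W ^+ 2 by exact: sqr_ge0.
have hk : k%:R ^+ 2 <= 4 / 3 * (k%:R ^+ 2 - 1) :> K by nra.
have n0 : 0 <= T * n%:R by rewrite mulr_ge0 ?ler0n// ltW.
have := ler_wpM2l n0 hk; have := ler_wpM2l W0 hs.
set X := \sum_x dev x ^+ 2 in hs hv *; set Y := \sum_x (_)%:~R ^+ 2 in hs h *.
move=> h1 h2.
rewrite -(ler_pM2l T0).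
have h3 : W ^+ 2 * (T * n%:R * k%:R ^+ 2) <= W ^+ 2 * (4 * X).
  by rewrite ler_wpM2l//; lra.
lra.
Qed.

Lemma level_size_le_width n k z : level_size (@grid_rank n k) z <= (width n k)%:R.
Proof.
pose A := [set x : grid n k | (grid_rank x)%:Z == z].
have -> : level_size (@grid_rank n k) z = #|A|%:R.
  rewrite /level_size -sum1_card natr_sum [RHS]big_mkcond.
  by apply: eq_bigr => x _; rewrite inE; case: eqP.
rewrite ler_nat; 
apply: (@bigop.leq_bigmax_cond _ (@antichain n k) (fun B : {set grid n k} => #|B|) A).
apply/forall_inP => x; rewrite inE => /eqP xz; apply/forall_inP => y; rewrite inE => /eqP yz.
by apply/implyP => xy; apply/eqP/grid_le_rank_eq => //; lia.
Qed.

(* Chebyshev: two thirds of the grid lie within [L] levels of the middle. *)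
Lemma width_lb n k : (0 < n)%N -> (2 <= k)%N ->
  (k ^ n)%:R ^+ 2 <= 36 * (n%:R * k%:R ^+ 2) * (width n k)%:R ^+ 2 :> K.
Proof.
move=> n0 k2; set T : K := (k ^ n)%:R.
have [L [L0 nkL Lnk]] : exists L, [/\ 0 < L, n * k ^ 2 <= L ^ 2 & L ^ 2 <= 4 * (n * k ^ 2)]%N.
  have exL : exists L, (n * k ^ 2 <= L ^ 2)%N by exists (n * k)%N; rewrite expnMn leq_mul2r; nia.
  have := ex_minnP exL; case=> -[|L] hL minL; first by nia.
  exists L.+1; split => //.
  have : (L ^ 2 < n * k ^ 2)%N by rewrite ltnNge; apply/negP => /minL; rewrite ltnn.
  by case: L {hL minL} => [|L]; nia.
pose near (x : grid n k) := `|dev x| < L%:R.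
have hin : \sum_(x : grid n k) (near x)%:R <= (L + L)%:R * (width n k)%:R :> K.
  pose a : int := ((n * k.-1) %/ 2)%N%:Z - L%:Z.
  apply: (@le_trans _ _ (\sum_(i < L + L) level_size (@grid_rank n k) (a + i%:Z))); last first.
    rewrite mulr_natl -[in leRHS](card_ord (L + L)) -sumr_const.
    by apply: ler_sum => i _; exact: level_size_le_width.
  rewrite exchange_big; apply: ler_sum => x _; rewrite /near.
  case: ltP => [|_]; last by apply: sumr_ge0 => i _; rewrite ler0n.
  rewrite /dev; have -> : k%:R - 1 = (k.-1)%:R :> K.
    by rewrite -{1}(@prednK k) -?natr1 ?addrK//; lia.
  rewrite -!natrM ltr_distl -natrD ltr_nat ltrBlDr -natrD ltr_nat => /andP[h1 h2].
  have iL : (`|(grid_rank x)%:Z - a| < L + L)%N by rewrite /a; lia.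
  rewrite (bigD1 (Ordinal iL))//= [X in X%:R + _](_ : _ = 1%N).
    by rewrite lerDl sumr_ge0// => i _; rewrite ler0n.
  by rewrite /a; case: eqP => //; lia.
have L0' : 0 < L%:R :> K by rewrite ltr0n.
have hout : L%:R ^+ 2 * (T - \sum_(x : grid n k) (near x)%:R) <= \sum_(x : grid n k) dev x ^+ 2.
  rewrite /T -card_grid -sum1_card natr_sum -sumrB mulr_sumr; apply: ler_sum => x _.
  rewrite /near; case: ltP => h; first by rewrite subrr mulr0 sqr_ge0.
  by rewrite subr0 mulr1 -[dev x ^+ 2]real_normK ?num_real// lerXn2r ?nnegrE ?ler0n ?normr_ge0.
have T0 : 0 <= T by exact: ler0n.
have hv := sum_dev_sq n k; rewrite -/T in hv.
set w : K := (width n k)%:R in hin *; set I := \sum_x (near x)%:R in hin hout.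
have nkL' : n%:R * k%:R ^+ 2 <= L%:R ^+ 2 :> K by rewrite -!natrX -natrM ler_nat.
have Lnk' : L%:R ^+ 2 <= 4 * (n%:R * k%:R ^+ 2) :> K by rewrite -!natrX -!natrM ler_nat.
have hI : 2 * T <= 3 * I.
  rewrite -(ler_pM2l (exprn_gt0 2 L0')).
  have : T * (n%:R * k%:R ^+ 2) <= T * L%:R ^+ 2 by rewrite ler_wpM2l.
  have : 0 <= T * n%:R by rewrite mulr_ge0.
  lra.
have w0 : 0 <= w by exact: ler0n.
have hT : T <= 3 * (L%:R * w) by rewrite natrD in hin; lra.
have : T ^+ 2 <= (3 * (L%:R * w)) ^+ 2 by rewrite lerXn2r ?nnegrE ?mulr_ge0// ltW.
have := ler_wpM2r (sqr_ge0 w) Lnk'; lra.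
Qed.
End Grids.

(** * Averaging over products of chains *)

Section Copies.
Import Order.TTheory GRing.Theory Num.Theory.
Local Open Scope ring_scope.
Variables (K : rcfType) (induced : bool) (T : finType) (leP : rel T).
Notation copy_free F := (~ has_copy induced leP F).

Lemma has_copy_preimset n k n' k' (e : grid n k -> grid n' k') (F : {set grid n' k'}) :
  (forall x y, grid_le (e x) (e y) = grid_le x y) ->
  has_copy induced leP (e @^-1: F) -> has_copy induced leP F.
Proof.
move=> ele [f [finj fF fle fge]].
have einj : injective e.
  have le x y : e x = e y -> grid_le x y by rewrite -ele => ->; exact: grid_le_refl.
  move=> x y exy; apply: grid_le_rank_eq; first exact: le.
  by apply/eqP; rewrite eqn_leq !grid_le_rank ?le.
exists (fun x => e (f x)); split => [x y /einj/finj//|x|x y|ind x y].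
- by have := fF x; rewrite inE.
- by rewrite ele; exact: fle.
- by rewrite ele; exact: fge.
Qed.

Lemma copy_free_add_coords n k (B : K) r :
  (forall F : {set grid n k}, copy_free F -> #|F|%:R <= B) ->
  forall F : {set grid (n + r) k}, copy_free F -> #|F|%:R <= (k ^ r)%:R * B.
Proof.
move=> hB; elim: r => [|r IH]; first by rewrite addn0 mul1r.
rewrite addnS => F hF; have -> : #|F|%:R = \sum_(j < k) #|(fun x => grid_cons (x, j)) @^-1: F|%:R :> K.
  under [RHS]eq_bigr do rewrite -sum1_card natr_sum big_mkcond.
  rewrite -sum1_card natr_sum big_mkcond sum_grid_cons exchange_big.
  by apply: eq_bigr => j _; apply: eq_bigr => x _; rewrite inE.
rewrite expnS natrM -mulrA -[X in X%:R * _](card_ord k) mulr_natl -sumr_const.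
apply: ler_sum => j _; apply: IH; apply: contra_not hF; apply: has_copy_preimset => x y.
by rewrite grid_le_cons /prod_le /= leqnn andbT.
Qed.

Lemma ord_mul_bij d N : exists (h : 'I_d * 'I_N -> 'I_(d * N)), bijective h.
Proof.
have e : #|{: 'I_d * 'I_N}| = #|'I_(d * N)| by rewrite card_prod !card_ord.
exists (fun p => enum_val (cast_ord e (enum_rank p))).
exists (fun i => enum_val (cast_ord (esym e) (enum_rank i))) => x.
  by rewrite enum_valK cast_ordK enum_rankK.
by rewrite enum_valK cast_ordKV enum_rankK.
Qed.

Lemma natr_forall d (P : pred 'I_d) :
  [forall b, P b]%:R = \prod_b (P b)%:R :> K.
Proof.
case: forallP => [h|/forallP]; first by rewrite big1// => b _; rewrite h.
by rewrite negb_forall => /existsP[b /negbTE Pb]; rewrite (bigD1 b)//= Pb mul0r.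
Qed.

(* Average over independent random chains in the [d] blocks: each point of
   [k]^(dN) is covered equally often by the resulting copies of [m]^d. *)
Lemma copy_free_blocks d N k m (B : K) :
  fractional_chain_cover K (@grid_le N k) m ->
  (forall F : {set grid d m}, copy_free F -> #|F|%:R <= B) ->
  forall F : {set grid (d * N) k}, copy_free F ->
    #|F|%:R * m%:R ^+ d <= B * (k ^ (d * N))%:R.
Proof.
move=> [Om [lam [c [lam0 cle cov]]]] hB F hF.
have [h [g hK gK]] := ord_mul_bij d N.
pose emb (w : {ffun 'I_d -> Om}) (a : grid d m) : grid (d * N) k :=
  [ffun i => c (w (g i).1) (a (g i).1) (g i).2].
pose wt (w : {ffun 'I_d -> Om}) := \prod_b lam (w b).
have emb_le w a b : wt w != 0 -> grid_le (emb w a) (emb w b) = grid_le a b.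
  move=> w0; have wb0 i : lam (w i) != 0.
    by move: w0; rewrite prodf_seq_neq0 => /allP/(_ i); rewrite mem_index_enum; apply.
  apply/forallP/forallP => [le i|le i].
    rewrite -(cle _ (wb0 i)); apply/forallP => j.
    by have := le (h (i, j)); rewrite !ffunE hK.
  by rewrite !ffunE; have := le (g i).1; rewrite -(cle _ (wb0 (g i).1)) => /forallP.
have fib w : wt w * #|emb w @^-1: F|%:R <= wt w * B.
  have [->|w0] := eqVneq (wt w) 0; first by rewrite !mul0r.
  rewrite ler_wpM2l ?prodr_ge0// hB//.
  by apply: contra_not hF; apply: has_copy_preimset => a b; exact: emb_le.
have embE w a x : (emb w a == x)%:R =
    \prod_b (c (w b) (a b) == [ffun j => x (h (b, j))])%:R :> K.
  rewrite -natr_forall; congr (nat_of_bool _)%:R; apply/eqP/forallP => [<- b|e].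
    by apply/eqP/ffunP => j; rewrite !ffunE hK.
  by apply/ffunP => i; rewrite ffunE (eqP (e _)) ffunE -surjective_pairing gK.
have cov_emb x : \sum_w \sum_a wt w * (emb w a == x)%:R = 1.
  under eq_bigr do under eq_bigr do rewrite embE -big_split /=.
  transitivity (\prod_(b < d) \sum_w \sum_(j < m)
      lam w * (c w j == [ffun i => x (h (b, i))])%:R); last by rewrite big1.
  by rewrite bigA_distr_bigA /=; apply: eq_bigr => w _; rewrite bigA_distr_bigA.
have cardF : \sum_w wt w * #|emb w @^-1: F|%:R = #|F|%:R.
  transitivity (\sum_w \sum_a \sum_(x in F) wt w * (emb w a == x)%:R).
    apply: eq_bigr => w _; rewrite -sum1_card natr_sum mulr_sumr big_mkcond.
    apply: eq_bigr => a _; rewrite inE; case: ifP => aF.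
      by rewrite (bigD1 (emb w a))//= eqxx big1 ?addr0// => x /andP[_ /negbTE]; rewrite eq_sym => ->; rewrite mulr0.
    by rewrite big1// => x xF; case: eqP => [e|_]; [rewrite e xF in aF|rewrite mulr0].
  under eq_bigr do rewrite exchange_big.
  rewrite exchange_big -sum1_card natr_sum /=.
  by apply: eq_bigr => x _; rewrite cov_emb.
have total : m%:R * \sum_w lam w = (k ^ N)%:R.
  rewrite -card_grid -sum1_card natr_sum; under [RHS]eq_bigr => x _ do rewrite -(cov x).
  rewrite exchange_big mulr_sumr; apply: eq_bigr => w _.
  rewrite exchange_big -{1}(card_ord m) mulr_natl -sumr_const; apply: eq_bigr => j _.
  rewrite (bigD1 (c w j))//= eqxx mulr1 big1 ?addr0// => x /negbTE.
  by rewrite eq_sym => ->; rewrite mulr0.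
have wtS : \sum_w wt w = (\sum_w lam w) ^+ d.
  by rewrite -[d in RHS](card_ord d) -prodr_const bigA_distr_bigA.
have kE : (k ^ (d * N) = (k ^ N) ^ d)%N by rewrite mulnC expnM.
rewrite -cardF kE natrX -total exprMn -wtS [B * _]mulrCA mulrC.
rewrite ler_wpM2l ?exprn_ge0 ?ler0n// mulr_sumr; apply: ler_sum => w _.
by rewrite [B * _]mulrC.
Qed.

Lemma set0_copy_free n k n' k' (F : {set grid n k}) :
  copy_free F -> copy_free (set0 : {set grid n' k'}).
Proof.
move=> hF [f [_ f0 _ _]]; apply: hF.
have T0 (x : T) : False by have := f0 x; rewrite inE.
by exists (fun x => False_rect _ (T0 x)); split => [x|x|x|_ x]; case: (T0 x).
Qed.

Lemma max_level_size (Q : finType) (rk : Q -> nat) : (0 < #|Q|)%N ->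
  exists h : nat, [/\ (0 < h <= #|Q|)%N, exists z, level_size K rk z = h%:R &
                     forall z, level_size K rk z <= h%:R].
Proof.
move=> Q0; pose A (z : int) := [set x | (rk x)%:Z == z].
have E z : level_size K rk z = #|A z|%:R.
  rewrite /level_size -sum1_card natr_sum [RHS]big_mkcond.
  by apply: eq_bigr => x _; rewrite inE; case: eqP.
have [x hx] := bigop.eq_bigmax (fun x => #|A (rk x)|) Q0.
exists #|A (rk x)|; split; [|by exists (rk x)|].
  by rewrite max_card andbT; apply/card_gt0P; exists x; rewrite inE.
move=> z; rewrite E ler_nat; have [->|[y]] := set_0Vmem (A z); first by rewrite cards0.
by rewrite inE => /eqP <-; rewrite -hx (bigop.leq_bigmax y).
Qed.

Lemma copy_free_grid_bound (d : nat) (C : K) : (0 < d)%N ->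
  (forall m, (0 < m)%N -> forall F : {set grid d m}, copy_free F ->
     #|F|%:R <= C * m%:R ^+ (d - 1)) ->
  forall k n : nat, (2 <= k)%N -> (d <= n)%N ->
  forall F : {set grid n k}, copy_free F ->
  #|F|%:R <= 136 * C * Num.sqrt d%:R * (width n k)%:R.
Proof.
move=> d0 hC k n k2 dn F hF.
have C0 : 0 <= C.
  have h0 : copy_free (set0 : {set grid d 1}) by apply: set0_copy_free hF.
  have := hC 1%N isT set0 h0; by rewrite cards0 expr1n mulr1.
pose N := (n %/ d)%N; pose r := (n %% d)%N.
have nE : n = (d * N + r)%N by rewrite mulnC -divn_eq.
have N0 : (0 < N)%N by rewrite divn_gt0.
have n2 : (n <= 2 * (d * N))%N by have := ltn_pmod n d0; rewrite -/r; nia.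
have Q0 : (0 < #|{: grid N k}|)%N by rewrite card_grid expn_gt0; lia.
have [h [/andP[h0 hT] [z hz] hub]] := max_level_size (@grid_rank N k) Q0.
rewrite card_grid in hT; pose m := (k ^ N %/ h)%N.
have m0 : (0 < m)%N by rewrite divn_gt0.
have [f ff] := normalized_flow_grid K N k.
have k0 : (0 < k)%N by lia.
have W0 : 0 < level_size K (@grid_rank N k) 0.
  have := level_size_gt0 K (@grid_rank N k) [ffun=> Ordinal k0].
  by rewrite /grid_rank big1// => i _; rewrite ffunE.
have cover : fractional_chain_cover K (@grid_le N k) m.
  apply: (fractional_chain_cover_of_flow (@grid_le_refl N k) (@grid_le_trans N k)
    (@grid_le_rank N k) (@log_concave_grid K N k) ff W0 hub m0).
  by rewrite card_grid leq_trunc_div.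
have mK : 0 < m%:R :> K by rewrite ltr0n.
have blocks (G : {set grid (d * N) k}) : copy_free G ->
    #|G|%:R <= C * (k ^ (d * N))%:R / m%:R.
  move=> /(copy_free_blocks cover (hC m m0)) hG.
  rewrite ler_pdivlMr// -(ler_pM2r (exprn_gt0 (d - 1) mK)).
  have -> : #|G|%:R * m%:R * m%:R ^+ (d - 1) = #|G|%:R * m%:R ^+ d :> K.
    by rewrite -mulrA -exprS; congr (_ * _ ^+ _); lia.
  by rewrite mulrAC.
have hFm : #|F|%:R * m%:R <= C * (k ^ n)%:R.
  have -> : (k ^ n)%:R = (k ^ (d * N))%:R * (k ^ r)%:R :> K by rewrite {1}nE expnD natrM.
  rewrite -ler_pdivlMr// mulrA mulrAC mulrC.
  by move: F hF; rewrite nE => F /(copy_free_add_coords blocks).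
have hNm : N%:R * k%:R ^+ 2 <= 256 * m%:R ^+ 2 :> K.
  have h2 := @level_size_grid_ub K N k z k2; rewrite hz in h2.
  have hK : 0 < h%:R ^+ 2 :> K by rewrite exprn_gt0// ltr0n.
  have hm : (k ^ N)%:R <= 2 * (m%:R * h%:R) :> K.
    rewrite -!natrM ler_nat; have : (k ^ N < m.+1 * h)%N by rewrite ltn_ceil.
    by nia.
  rewrite -(ler_pM2l hK) (le_trans h2)//.
  have : (k ^ N)%:R ^+ 2 <= (2 * (m%:R * h%:R)) ^+ 2 :> K.
    by rewrite lerXn2r ?nnegrE ?mulr_ge0 ?ler0n.
  lra.
have hw : (k ^ n)%:R <= 136 * Num.sqrt d%:R * m%:R * (width n k)%:R :> K.
  have n0 : (0 < n)%N by lia.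
  have h1 := @width_lb K n k n0 k2.
  have h2 : n%:R <= 2 * (d%:R * N%:R) :> K by rewrite -!natrM ler_nat.
  have dK : 0 <= d%:R :> K by exact: ler0n.
  have w2 : 0 <= (width n k)%:R ^+ 2 :> K by exact: sqr_ge0.
  rewrite -ler_sqr ?nnegrE ?mulr_ge0 ?ler0n ?sqrtr_ge0//.
  rewrite !exprMn sqr_sqrtr//.
  have h3 : n%:R * k%:R ^+ 2 <= 512 * (d%:R * m%:R ^+ 2) :> K.
    have := ler_wpM2r (sqr_ge0 (k%:R : K)) h2; have := ler_wpM2l dK hNm; lra.
  have h4 : 0 <= d%:R * m%:R ^+ 2 * (width n k)%:R ^+ 2 :> K.
    by rewrite !mulr_ge0 ?sqr_ge0.
  have := ler_wpM2r w2 h3; lra.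
rewrite -(ler_pM2r mK) (le_trans hFm)//.
have := ler_wpM2l C0 hw; lra.
Qed.
End Copies.

From mathcomp Require Import Rstruct.
From Stdlib Require Import Reals.

Theorem theorem2p4 :
  exists K : R,
  forall (induced : bool) (T : finType) (leP : rel T),
    reflexive leP -> antisymmetric leP -> transitive leP ->
  forall (d : nat) (C : R), (0 < d)%N ->
    (forall (m : nat), (0 < m)%N ->
       forall F : {set grid d m}, ~ has_copy induced leP F ->
       (INR #|F| <= C * INR m ^ (d - 1))%R) ->
  forall (k n : nat), (2 <= k)%N -> (d <= n)%N ->
    forall F : {set grid n k}, ~ has_copy induced leP F ->
    (INR #|F| <= K * C * sqrt (INR d) * INR (width n k))%R.
Proof.
exists (INR 136) => induced T leP _ _ _ d C d0 hC k n k2 dn F hF.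
apply/RleP; rewrite RsqrtE !INRE.
apply: (copy_free_grid_bound d0 _ k2 dn hF) => m m0 G hG.
by have /RleP := hC m m0 G hG; rewrite RpowE !INRE.
Qed.
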